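(* Let $D=(V,A)$ be a strong s-quadrangular digraph with at least two vertices. Then $D$ has a cycle factor, i.e. a collection of pairwise vertex-disjoint directed cycles of $D$ such that every vertex of $D$ lies on one of them.
   Context: All digraphs are finite, without loops or multiple arcs. For $x\neq y$, $x$ dominates $y$ if $xy\in A$. $N^+(x)$ is the set of vertices dominated by $x$ (out-neighbors) and $N^-(x)$ the set of vertices dominating $x$ (in-neighbors). A set $S\subseteq V$ is a $q^+$-set ($q^-$-set, respectively) if $|S|\ge 2$ and for every $u\in S$ there is $v\in S$, $v\neq u$, with $N^+(u)\cap N^+(v)\neq\emptyset$ ($N^-(u)\cap N^-(v)\neq\emptyset$, respectively). $D$ is s-quadrangular if for every $q^+$-set $S$, $\left|\bigcup\{N^+(u)\cap N^+(v): u\neq v,\ u,v\in S\}\right|\ge |S|$, and for every $q^-$-set $S$, $\left|\bigcup\{N^-(u)\cap N^-(v): u\neq v,\ u,v\in S\}\right|\ge |S|$. $D$ is strong if for every ordered pair $x,y$ of vertices there is a directed path from $x$ to $y$. *)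

(* Defs.v *)
From mathcomp Require Import all_boot.

Set Implicit Arguments.
Unset Strict Implicit.
Unset Printing Implicit Defensive.

(* A finite digraph without loops or multiple arcs is given by a finType V and
   an irreflexive arc relation A : rel V, where A x y means "x dominates y". *)

Definition out_nbrs (V : finType) (A : rel V) (x : V) : {set V} :=
  [set y | A x y].

Definition in_nbrs (V : finType) (A : rel V) (x : V) : {set V} :=
  [set y | A y x].

(* N is out_nbrs A for q^+-sets, and in_nbrs A for q^--sets. *)
Definition q_set (V : finType) (N : V -> {set V}) (S : {set V}) : Prop :=
  2 <= #|S| /\
  forall u, u \in S ->
    exists v, [/\ v \in S, v != u & N u :&: N v != set0].

Definition common_nbrs (V : finType) (N : V -> {set V}) (S : {set V}) :
    {set V} :=
  \bigcup_(u in S) \bigcup_(v in S | u != v) (N u :&: N v).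

Definition s_quadrangular (V : finType) (A : rel V) : Prop :=
  (forall S : {set V}, q_set (out_nbrs A) S ->
     #|S| <= #|common_nbrs (out_nbrs A) S|) /\
  (forall S : {set V}, q_set (in_nbrs A) S ->
     #|S| <= #|common_nbrs (in_nbrs A) S|).

Definition strong (V : finType) (A : rel V) : Prop :=
  forall x y : V, connect A x y.

(* The library's ucycle accepts the empty sequence, hence the size condition;
   opposite arcs xy, yx do form a directed cycle of length 2. *)
Definition directed_cycle (V : finType) (A : rel V) (c : seq V) : Prop :=
  2 <= size c /\ ucycle A c.

Definition cycle_factor (V : finType) (A : rel V) (cs : seq (seq V)) : Prop :=
  [/\ forall c, c \in cs -> directed_cycle A c,
      pairwise (fun c d => [disjoint c & d]) cs
    & forall x : V, exists2 c, c \in cs & x \in c].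

(* Main.v *)
(* Hall's condition for the bipartite graph with parts V, V and edges the arcs
   of D follows from the q^+ condition: given X, let S be the set of the u in X
   sharing an out-neighbor with another vertex of X.  Then S is empty or a
   q^+-set, so N^+(S) has at least #|S| elements, while the vertices of X \ S
   have nonempty out-neighborhoods (D is strong), disjoint from each other and
   from N^+(S).  A perfect matching of that bipartite graph is a permutation f
   of V with x -> f x an arc for all x, and the orbits of f are the cycles. *)

Require Import Defs.
From mathcomp Require Import all_boot.

Set Implicit Arguments.
Unset Strict Implicit.
Unset Printing Implicit Defensive.

Section Hall.

Variables T U : finType.
Implicit Types (N : T -> {set U}) (X Y : {set T}).

Definition hall_condition N :=
  [forall X : {set T}, #|X| <= #|\bigcup_(x in X) N x|].

Definition delete_choice N x a : T -> {set U} :=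
  fun y => if y == x then N x :\ a else N y.

Lemma hall_conditionP N :
  reflect (forall X, #|X| <= #|\bigcup_(x in X) N x|) (hall_condition N).
Proof. exact: forallP. Qed.

Lemma bigcup_delete_choice_notin N x a X : x \notin X ->
  \bigcup_(y in X) delete_choice N x a y = \bigcup_(y in X) N y.
Proof.
move=> xX; apply: eq_bigr => y yX; rewrite /delete_choice.
by case: eqP => // eyx; rewrite -eyx yX in xX.
Qed.

(** A set violating Hall's condition after the deletion must contain [x], since other sets keep
    their neighborhoods. Removing [x] from it lowers its size by one, which turns the strict
    inequality into a weak one. *)
Lemma hall_delete_failure N x a :
  hall_condition N -> ~~ hall_condition (delete_choice N x a) ->
  exists2 X : {set T}, x \notin X & #|N x :\ a :|: \bigcup_(y in X) N y| <= #|X|.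
Proof.
move=> /hall_conditionP hallN; rewrite negb_forall => /existsP[Y].
rewrite -ltnNge => ltY.
have xY : x \in Y.
  apply: contraLR ltY => xY.
  by rewrite -leqNgt bigcup_delete_choice_notin.
exists (Y :\ x); first by rewrite setD11.
rewrite -ltnS (cardsD1 x Y) xY add1n in ltY *.
move: ltY; rewrite (big_setD1 x xY) /= bigcup_delete_choice_notin ?setD11 //.
by rewrite {1}/delete_choice eqxx.
Qed.

(* Rado's argument: were both deletions harmful, submodularity of
   X |-> #|N(X)| would violate Hall's condition. *)
Lemma hall_delete N x a b :
  hall_condition N -> a != b ->
  hall_condition (delete_choice N x a) || hall_condition (delete_choice N x b).
Proof.
move=> hallN neq_ab; apply/negPn; rewrite negb_or; apply/negP => /andP[].
move=> /(hall_delete_failure hallN)[X xX leX].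
move=> /(hall_delete_failure hallN)[Y xY leY].
move/hall_conditionP: hallN => hallN.
have := leq_add leX leY; rewrite leqNgt; case/negP.
have xXY : x \notin X :|: Y by rewrite in_setU negb_or xX.
(* The extra 1 of the strict inequality counts [x] in the union: as [a != b], the two reduced copies
   of [N x] together recover [N x]. *)
rewrite -cardsUI -[in ltnRHS]cardsUI -addSn.
apply: leq_add.
  have -> : #|X :|: Y|.+1 = #|x |: (X :|: Y)| by rewrite cardsU1 xXY.
  apply: leq_trans (hallN _) (subset_leq_card _).
  apply/bigcupsP => y; rewrite !inE => /or3P[/eqP->|yX|yY];
    apply/subsetP => u uN; rewrite !inE.
  - by case: (u =P a) => [eq_ua|_]; rewrite uN ?eq_ua ?neq_ab ?orbT.
  - by have -> : u \in \bigcup_(z in X) N z;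
      [apply/bigcupP; exists y | rewrite !orbT].
  - by have -> : u \in \bigcup_(z in Y) N z;
      [apply/bigcupP; exists y | rewrite !orbT].
apply: leq_trans (hallN _) (subset_leq_card _).
apply/bigcupsP => y; rewrite inE => /andP[yX yY].
apply/subsetP => u uN; rewrite !inE.
apply/andP; split; apply/orP; right; apply/bigcupP; by exists y.
Qed.

(** Induction on the total size of the sets [N x]: any set with two elements can lose one of them by
    [hall_delete]. Once all are singletons, Hall's condition on pairs forces them to be distinct. *)
Lemma hall_marriage N :
  hall_condition N -> exists2 f : T -> U, injective f & forall x, f x \in N x.
Proof.
have [n] := ubnP (\sum_x #|N x|); elim: n N => // n IHn N leNn hallN.
case: (pickP (fun x => 1 < #|N x|)) => [x /card_gt1P[a [b [aN bN neq_ab]]]|small].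
  have [c cN hallc] : exists2 c, c \in N x & hall_condition (delete_choice N x c).
    by case/orP: (hall_delete x hallN neq_ab) => ?; [exists a | exists b].
  have [|f f_inj fN] := IHn _ _ hallc.
    rewrite -ltnS; apply: leq_trans leNn; rewrite ltnS.
    rewrite (bigD1 x) //= [ltnRHS](bigD1 x) //= {1}/delete_choice eqxx.
    rewrite (eq_bigr (fun y => #|N y|)); last first.
      by move=> y /negPf yx; rewrite /delete_choice yx.
    by rewrite (cardsD1 c (N x)) cN add1n addSn.
  exists f => // y; have := fN y; rewrite /delete_choice.
  by case: eqP => // ->; rewrite inE => /andP[].
move/hall_conditionP: hallN => hallN.
have N1 x : exists u, N x == [set u].
  have /cards1P[u ->] : #|N x| == 1; last by exists u.
  rewrite eqn_leq leqNgt small /=.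
  by have := hallN [set x]; rewrite cards1 big_set1.
pose f x := xchoose (N1 x).
have fE x : N x = [set f x] by apply/eqP; exact: (xchooseP (N1 x)).
exists f => [x y eq_f|x]; last by rewrite fE set11.
apply/eqP; apply/negPn/negP => neq_xy.
have := hallN [set x; y]; rewrite cards2 neq_xy /=.
by rewrite big_setU1 ?inE //= big_set1 !fE eq_f setUid cards1.
Qed.

End Hall.

Lemma strong_out_nbrs_neq0 (V : finType) (A : rel V) (x : V) :
  1 < #|V| -> strong A -> out_nbrs A x != set0.
Proof.
move=> /card_gt1P[a [b [_ _ neq_ab]]] strongA.
have [y neq_yx] : exists y, y != x.
  by case: (eqVneq a x) => [<-|]; [exists b; rewrite eq_sym | exists a].
have /connectP[[|z p] /= Ap eq_y] := strongA x y.
  by rewrite eq_y eqxx in neq_yx.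
by apply/set0Pn; exists z; rewrite inE; case/andP: Ap.
Qed.

Lemma q_set_hall (V : finType) (N : V -> {set V}) :
  (forall x, N x != set0) ->
  (forall S : {set V}, q_set N S -> #|S| <= #|common_nbrs N S|) ->
  hall_condition N.
Proof.
move=> N_neq0 qN; apply/hall_conditionP => X.
pose shares x := [exists y in X, (y != x) && (N x :&: N y != set0)].
pose S := [set x in X | shares x].
have leS : #|S| <= #|\bigcup_(x in S) N x|.
  have [->|/set0Pn[x xS]] := eqVneq S set0; first by rewrite cards0.
  (* Sharing is symmetric, so the partner of [u] found in [X] lies in [S] as well. *)
  have qS u : u \in S -> exists v, [/\ v \in S, v != u & N u :&: N v != set0].
    rewrite inE => /andP[uX /exists_inP[v vX /andP[neq_vu Nuv]]].
    exists v; split=> //; rewrite inE vX; apply/exists_inP; exists u => //.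
    by rewrite eq_sym neq_vu setIC.
  apply: leq_trans (qN S _) (subset_leq_card _).
    split=> //; have [y [yS neq_yx _]] := qS x xS.
    by apply/card_gt1P; exists x, y; rewrite eq_sym.
  apply/bigcupsP => u uS; apply/bigcupsP => v _.
  exact: subset_trans (subsetIl _ _) (bigcup_sup u uS).
(* One representative neighbor per vertex; the default is never reached, because [N x] is
   nonempty. *)
pose g x := odflt x [pick y in N x].
have gN x : g x \in N x.
  rewrite /g; case: pickP => //= Nx0; case/set0Pn: (N_neq0 x) => y.
  by rewrite [y \in _]Nx0.
(* This yields both the injectivity of [g] on [X :\: S] and the disjointness of its image from the
   neighborhood of [S]. *)
have alone x y u : x \in X :\: S -> y \in X -> u \in N x -> u \in N y -> x = y.
  rewrite !inE => /andP[+ xX] yX uNx uNy; rewrite xX /= => /exists_inPn/(_ y yX).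
  rewrite negb_and negbK => /orP[/eqP //|/negPn/eqP Nxy].
  by have := in_set0 u; rewrite -Nxy inE uNx uNy.
have sSX : S \subset X by apply/subsetP => x; rewrite inE => /andP[].
have card_g : #|g @: (X :\: S)| = #|X :\: S|.
  apply: card_in_imset => x y xT yT eq_g.
  by apply: (alone x y (g x)) => //; [case/setDP: yT | rewrite eq_g].
have disj : [disjoint \bigcup_(x in S) N x & g @: (X :\: S)].
  apply/pred0P => u /=; apply/negP => /andP[/bigcupP[y yS uNy] /imsetP[x xT eq_u]].
  have eq_xy : x = y.
    by apply: (alone x y u) => //; [exact: (subsetP sSX) | rewrite eq_u].
  by move: xT; rewrite eq_xy inE yS.
rewrite -(cardsID S X) (setIidPr sSX) -card_g.
apply: leq_trans (leq_add leS (leqnn _)) _.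
rewrite -cardsUI; move: disj; rewrite -setI_eq0 => /eqP->; rewrite cards0 addn0.
apply: subset_leq_card; rewrite subUset; apply/andP; split.
  by apply/bigcupsP => x xS; apply: bigcup_sup; apply: (subsetP sSX).
apply/subsetP => u /imsetP[x /setDP[xX _] ->]; apply/bigcupP; by exists x.
Qed.

(** An injective self-map of a finite set is a permutation, so its orbits partition [V]; each is
    listed once, through its canonical root. *)
Lemma injective_cycle_factor (V : finType) (A : rel V) (f : V -> V) :
  irreflexive A -> injective f -> (forall x, A x (f x)) ->
  exists cs : seq (seq V), cycle_factor A cs.
Proof.
move=> A_irr f_inj Af; have f_sym := fconnect_sym f_inj.
exists [seq orbit f x | x <- enum (froots f)]; split.
- move=> c /mapP[x _ ->]; split.
    (* Without loops [f] has no fixed point, so every orbit has at least two elements. *)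
    have neq_xf : x != f x.
      by apply/eqP => eq_xf; have := Af x; rewrite -eq_xf A_irr.
    rewrite size_orbit /order; apply/card_gt1P; exists x, (f x).
    by split; rewrite ?inE ?fconnect1 ?connect0.
  apply/andP; split; last exact: orbit_uniq.
  by apply: sub_cycle (cycle_orbit f_inj x) => y z /= /eqP <-.
- rewrite pairwise_map; have: uniq (enum (froots f)) := enum_uniq _.
  rewrite uniq_pairwise; apply: (sub_in_pairwise (P := froots f)) => [x y rx ry /= neq_xy|].
    apply/pred0P => z /=; apply/negP; rewrite -!fconnect_orbit.
    move=> /andP[xz yz]; case/negP: neq_xy.
    (* Two orbits with a common element [z] have the same root. *)
    rewrite -(eqP rx) -(eqP ry) root_connect //.
    by apply: connect_trans xz _; rewrite f_sym.
  by apply/allP => x; rewrite mem_enum.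
- move=> x; exists (orbit f (froot f x)).
    by apply: map_f; rewrite mem_enum; apply: roots_root.
  by rewrite -fconnect_orbit f_sym connect_root.
Qed.

Theorem theorem2p2 (V : finType) (A : rel V) (A_irr : irreflexive A)
    (V_ge2 : 2 <= #|V|) (A_strong : strong A) (A_sq : s_quadrangular A) :
  exists cs : seq (seq V), cycle_factor A cs.
Proof.
have N_neq0 x : out_nbrs A x != set0 by exact: strong_out_nbrs_neq0.
have [f f_inj fN] := hall_marriage (q_set_hall N_neq0 A_sq.1).
apply: (injective_cycle_factor A_irr f_inj) => x.
by have := fN x; rewrite inE.
Qed.
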